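(* For all $n\ge 1$, $j\ge 0$ and $k\ge 2$, $$\sum_{j\ge i_{k-1}\ge\cdots\ge i_1\ge 0}\ \prod_{m=0}^{k-1}\binom{i_{m+2}+i_m}{2i_{m+1}}=N(n,j+1)-\Big[\widetilde Q_1(n,j,k+2)-2\widetilde Q_0(n,j,k+2)+\widetilde Q_{-1}(n,j,k+2)\Big],$$ where $i_0:=0$, $i_k:=j$, $i_{k+1}:=n$ (the sum is over integers $i_1,\dots,i_{k-1}$), $N(n,j+1)=\frac1n\binom{n}{j+1}\binom{n}{j}$, and $$\widetilde Q_a(n,j,k+2)=\sum_{s\ge1}\binom{n-(k+1)s-1}{j-(k+2)s-a}\binom{n+(k+1)s-1}{j+(k+2)s+a}.$$
   Context: Binomial coefficients $\binom{p}{q}$ with $q<0$ are $0$. *)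

(* Defs.v *)
(* MathComp, with the finitely supported sums of mathcomp-classical. *)
From mathcomp Require Import all_boot all_order all_algebra.
From mathcomp Require Import classical_sets functions cardinality fsbigop.
From mathcomp Require Import zify.

Set Implicit Arguments.
Unset Strict Implicit.
Unset Printing Implicit Defensive.

Import Order.TTheory GRing.Theory Num.Theory.

Local Open Scope classical_set_scope.
Local Open Scope ring_scope.

(* p (p - 1) ... (p - q + 1) / q! for integers p and q >= 0 (p may be
   negative), and 0 for q < 0. *)
Definition binz (p q : int) : rat :=
  match q with
  | Posz q' => (\prod_(i < q') (p - i%:Z))%:~R / q'`!%:R
  | Negz _ => 0
  end.

Lemma binz_lt0 (p q : int) : q < 0 -> binz p q = 0.
Proof. by case: q. Qed.

Lemma binz_nat (p q : nat) : binz p%:Z q%:Z = 'C(p, q)%:R.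
Proof.
have h : \prod_(i < q) (p%:Z - i%:Z) = (p ^_ q)%:Z.
  elim: q => [|q IH]; first by rewrite big_ord0.
  rewrite big_ord_recr /= IH ffactnSr PoszM.
  have [qp|pq] := leqP q p; first by rewrite subzn.
  by rewrite ffact_small // !mul0r.
rewrite /binz h -bin_ffact PoszM rmorphM /= mulfK //.
by rewrite pnatr_eq0 -lt0n fact_gt0.
Qed.

Definition narayana (n k : nat) : rat :=
  n%:R^-1 * 'C(n, k)%:R * 'C(n, k.-1)%:R.

Definition Qtilde_term (a : int) (n j r s : nat) : rat :=
  binz (n%:Z - (r%:Z - 1) * s%:Z - 1) (j%:Z - r%:Z * s%:Z - a) *
  binz (n%:Z + (r%:Z - 1) * s%:Z - 1) (j%:Z + r%:Z * s%:Z + a).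

(* The sum over an infinite set defaults to 0 when infinitely many terms are
   nonzero; Qtilde_finite_support shows that this does not happen here. *)
Definition Qtilde (a : int) (n j r : nat) : rat :=
  \sum_(s \in [set s : nat | (1 <= s)%N]) Qtilde_term a n j r s.

Lemma Qtilde_finite_support (a : int) (n j r : nat) : (0 < r)%N ->
  finite_set ([set s : nat | (1 <= s)%N] `&`
              Qtilde_term a n j r @^-1` [set~ 0]).
Proof.
move=> r0; apply: (@sub_finite_set _ _ `I_(j + `|a|).+1); last first.
  exact: finite_II.
move=> s [/= _ nz]; rewrite ltnNge; apply/negP => les; apply: nz.
by rewrite /Qtilde_term binz_lt0 ?mul0r //; nia.
Qed.

(* The sequence (i_0, i_1, ..., i_(k-1), i_k, i_(k+1)) with i_0 = 0, i_k = j
   and i_(k+1) = n, where i lists i_1, ..., i_(k-1). *)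
Definition ext_seq (n j : nat) (i : seq nat) : seq nat := 0%N :: i ++ [:: j; n].

(* The (k-1)-tuples 0 <= i_1 <= ... <= i_(k-1) <= j are the sorted tuples over
   'I_j.+1. *)
Definition chain_sum (n j k : nat) : nat :=
  (\sum_(i : k.-1.-tuple 'I_j.+1 | sorted leq (map val i))
     let I := nth 0 (ext_seq n j (map val i)) in
     \prod_(0 <= m < k) 'C(I (m + 2) + I m, 2 * I (m + 1)))%N.

(* Main.v *)
(* Write T_{a,b,c}(n,j) = C(n-a-1, j-b-c) C(n+a-1, j+b+c) and
   D_{a,b} = 2 T_{a,b,0} - T_{a,b,1} - T_{a,b,-1}.  The chain sum satisfies
   S_{k+1}(n,j) = sum_i C(n+i, 2j) S_k(j,i), and so does the right-hand side,
   term by term in s: by Nanjundiah's identity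
     sum_i C(n+i-1, P+Q) C(P, i+b) C(Q, i-b) = C(n-b-1, P-2b) C(n+b-1, Q+2b)
   together with Pascal's rule,
     sum_i C(n+i, 2j) D_{a,b}(j,i) = D_{b,2b-a}(n,j),
   and (a,b) = (rs, (r+1)s) is sent to ((r+1)s, (r+2)s).  The Narayana number is
   half of the term s = 0.  The recursion can be started one step below k = 0,
   at r = 0, where D_{0,s} is a second difference in s and the sum telescopes
   to 0; the column j = 0, which the recursion does not reach, is trivial. *)
Require Import Defs.
From mathcomp Require Import all_boot all_order all_algebra.
From mathcomp Require Import classical_sets fsbigop.
From mathcomp Require Import zify ring lra.
Import Order.TTheory GRing.Theory Num.Theory.
Local Open Scope ring_scope.

Arguments binz : simpl never.

(** * Nanjundiah's identity over the naturals *)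

Lemma mul_bin_trinomial (n m p : nat) :
  (p <= m)%N -> ('C(n, m) * 'C(m, p) = 'C(n, p) * 'C(n - p, m - p))%N.
Proof.
move=> pm; have [nm|mn] := ltnP n m.
  rewrite bin_small //; have [np|pn] := ltnP n p; first by rewrite ['C(n, p)]bin_small.
  by rewrite ['C(n - p, _)]bin_small ?muln0 //; lia.
have pn := leq_trans pm mn.
have e1 := bin_fact mn; have e2 := bin_fact pm; have e3 := bin_fact pn.
have e4 : ('C(n - p, m - p) * ((m - p)`! * (n - m)`!) = (n - p)`!)%N.
  have -> : (n - m = (n - p) - (m - p))%N by lia.
  by rewrite bin_fact //; lia.
have f1 := fact_gt0 p; have f2 := fact_gt0 (m - p); have f3 := fact_gt0 (n - m).
apply/eqP; rewrite -(eqn_pmul2r f1) -(eqn_pmul2r f2) -(eqn_pmul2r f3); apply/eqP.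
transitivity n`!.
  by rewrite -[RHS]e1 -e2; ring.
by rewrite -[LHS]e3 -e4; ring.
Qed.

(* Expand ['C(y + l, p + q)] by Vandermonde, then sum over [l] first. *)
Lemma nanjundiah (p q y e : nat) : (e <= p)%N ->
  (\sum_(l < e.+1) 'C(y + l, p + q) * ('C(p, e - l) * 'C(q, l)) =
   'C(y + e - p, e) * 'C(y, p + q - e))%N.
Proof.
move=> ep; pose u := (p + q - e)%N.
(* Trinomial revision of ['C(q, l) * 'C(l, t)] frees ['C(q, t)]; Vandermonde then sums over [l]. *)
have inner t : (t <= e)%N ->
    (\sum_(l < e.+1) 'C(l, t) * ('C(p, e - l) * 'C(q, l)) =
     'C(q, t) * 'C(p + q - t, e - t))%N.
  move=> te; have [qt|tq] := ltnP q t.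
    rewrite (bin_small qt) mul0n; apply: big1 => l _.
    have [lt|tl] := ltnP l t; first by rewrite bin_small.
    by rewrite ['C(q, l)]bin_small ?muln0 //; lia.
  have -> : (p + q - t = q - t + p)%N by lia.
  rewrite -binomial.Vandermonde big_distrr /=.
  rewrite -(big_mkord xpredT (fun l => 'C(l, t) * ('C(p, e - l) * 'C(q, l)))%N).
  rewrite (big_cat_nat (n := t)) ?leqW //= big_nat_cond big1 ?add0n; last first.
    by move=> l /andP[/andP[_ lt] _]; rewrite bin_small.
  rewrite -{1}[t]add0n big_addn big_mkord subSn //; apply: eq_bigr => l _.
  have := mul_bin_trinomial q (l + t) t (leq_addl l t); rewrite addnK => tri.
  rewrite [RHS]mulnA -tri [(l + t)%N]addnC subnDA; ring.
have vdm l : (l <= e)%N ->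
    'C(y + l, p + q) = (\sum_(t < e.+1) 'C(l, t) * 'C(y, p + q - t))%N.
  move=> le; rewrite addnC -binomial.Vandermonde.
  rewrite -!(big_mkord xpredT (fun t => 'C(l, t) * 'C(y, p + q - t))%N).
  rewrite (big_cat_nat (n := e.+1)) //=; last by rewrite ltnS; lia.
  rewrite [X in (_ + X)%N]big_nat_cond [X in (_ + X)%N]big1 ?addn0 //.
  by move=> t /andP[/andP[et _] _]; rewrite bin_small //; lia.
transitivity (\sum_(t < e.+1) 'C(q, t) * ('C(y, p + q - t) * 'C(p + q - t, e - t)))%N.
  under eq_bigr => l _ do rewrite (vdm l) -1?ltnS ?ltn_ord // big_distrl /=.
  rewrite exchange_big /=; apply: eq_bigr => t _.
  rewrite mulnCA -inner -1?ltnS ?ltn_ord // big_distrr /=.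
  by apply: eq_bigr => l _; ring.
have tri (t : 'I_e.+1) : ('C(q, t) * ('C(y, p + q - t) * 'C(p + q - t, e - t)) =
    'C(q, t) * 'C(y - u, e - t) * 'C(y, u))%N.
  have te : (t <= e)%N by rewrite -ltnS.
  have h : (u <= p + q - t)%N by rewrite /u; lia.
  rewrite -mulnA; congr (_ * _)%N.
  rewrite -(bin_sub (n := p + q - t)); last by lia.
  have -> : (p + q - t - (e - t) = u)%N by rewrite /u; lia.
  rewrite (mul_bin_trinomial _ _ _ h) mulnC; congr ('C(_, _) * _)%N.
  by rewrite /u; lia.
under eq_bigr do rewrite tri.
rewrite -big_distrl /= binomial.Vandermonde.
(* Truncated subtraction: [q + (y - u)] equals [y + e - p] only if [u <= y]; otherwise the factor
   ['C(y, u)] kills both sides. *)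
have [yu|uy] := ltnP y u; first by rewrite (bin_small yu) !muln0.
by congr ('C(_, _) * _)%N; rewrite /u in uy *; lia.
Qed.

(** * Passage to integer lower indices *)

Lemma binz_small (p q : int) : 0 <= p < q -> binz p q = 0.
Proof.
case: p q => [p|p] [q|q] //; rewrite binz_nat => /andP[_ pq].
by rewrite bin_small.
Qed.

Lemma binz_pascal (p : nat) (q : int) :
  binz p.+1%:Z q = binz p%:Z q + binz p%:Z (q - 1).
Proof.
case: q => [[|q]|q]; first by rewrite !binz_nat !bin0 binz_lt0 ?addr0.
  have -> : q.+1%:Z - 1 = q%:Z by lia.
  by rewrite !binz_nat binS natrD.
by rewrite !binz_lt0 ?addr0 //; lia.
Qed.

(** This is [nanjundiah] at [y = n + b - 1], [e = p - 2b], with [i] shifted by [b]. The bound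
    [p <= l + b] makes the range reach the last nonzero term, [i = p - b]. *)
Lemma sum_binz (p q n b l : nat) : (b < n)%N -> (p <= l + b)%N ->
  \sum_(i < l.+1) 'C(n + i - 1, p + q)%:R *
    (binz p%:Z (i%:Z + b%:Z) * binz q%:Z (i%:Z - b%:Z)) =
  binz (n%:Z - b%:Z - 1) (p%:Z - 2 * b%:Z) *
  binz (n%:Z + b%:Z - 1) (q%:Z + 2 * b%:Z).
Proof.
move=> bn pl; have [p2b|b2p] := ltnP p (2 * b).
  rewrite [X in _ = X * _]binz_lt0 ?mul0r; last by lia.
  apply: big1 => i _; have [ib|bi] := ltnP i b.
    by rewrite [binz q _]binz_lt0 ?mulr0 //; lia.
  by rewrite [binz p _]binz_small ?mul0r ?mulr0 //; lia.
pose e := (p - 2 * b)%N.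
have -> : n%:Z - b%:Z - 1 = (n - b - 1)%N%:Z by lia.
have -> : n%:Z + b%:Z - 1 = (n + b - 1)%N%:Z by lia.
have -> : p%:Z - 2 * b%:Z = e%:Z by rewrite /e; lia.
have -> : q%:Z + 2 * b%:Z = (p + q - e)%N%:Z by rewrite /e; lia.
rewrite !binz_nat -natrM.
have -> : (n - b - 1 = n + b - 1 + e - p)%N by rewrite /e; lia.
rewrite -nanjundiah ?leq_subr // natr_sum.
rewrite -(big_mkord xpredT (fun i => 'C(n + i - 1, p + q)%:R *
    (binz p%:Z (i%:Z + b%:Z) * binz q%:Z (i%:Z - b%:Z)))).
rewrite (big_cat_nat (n := b)) ?leqW //=; last by lia.
rewrite big_nat_cond big1 ?add0r; last first.
  move=> i /andP[/andP[_ ib] _].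
  by rewrite [binz q _]binz_lt0 ?mulr0 //; lia.
rewrite (big_cat_nat (n := e.+1 + b)) /=; [|lia|by rewrite /e; lia].
rewrite [X in _ + X]big_nat_cond [X in _ + X]big1 ?addr0; last first.
  move=> i /andP[/andP[ei _] _].
  by rewrite [binz p _]binz_small ?mul0r ?mulr0 //; move: ei; rewrite /e; lia.
rewrite -{1}[b]add0n big_addn addnK big_mkord; apply: eq_bigr => l' _.
have le : (l' <= e)%N by rewrite -ltnS.
have -> : (l' + b)%N%:Z + b%:Z = (p - (e - l'))%N%:Z by move: le; rewrite /e; lia.
have -> : (l' + b)%N%:Z - b%:Z = l'%:Z by lia.
rewrite !binz_nat bin_sub; last by rewrite /e; lia.
by rewrite !natrM; congr ('C(_, _)%:R * _); lia.
Qed.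

(** * Second differences and their recursion *)

(* The s-th term of Q~_c(n, j, r) is [cyl] at a = (r-1)s, b = rs. *)
Definition cyl (a b c : int) (n j : nat) : rat :=
  binz (n%:Z - a - 1) (j%:Z - b - c) * binz (n%:Z + a - 1) (j%:Z + b + c).

Definition cyl_det (a b : int) (n j : nat) : rat :=
  2 * cyl a b 0 n j - cyl a b 1 n j - cyl a b (-1) n j.

Lemma cyl_det_eq0 (a b : int) (n j : nat) :
    (forall c, -1 <= c <= 1 -> cyl a b c n j = 0) -> cyl_det a b n j = 0.
Proof. by move=> h; rewrite /cyl_det !h ?mulr0 ?subr0. Qed.

(* Pascal's rule writes [cyl_det] in the binomials produced by Nanjundiah's
   identity for (P, Q) = (j+a, j-a), (j+a-1, j-a+1), (j+a+1, j-a-1). *)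
Lemma cyl_det_shift (a q b i : nat) :
  cyl_det a%:Z b%:Z (a + q.+1) i =
    2 * (binz (2 * a + q).+1%:Z (i.+1%:Z + b%:Z) * binz q.+1%:Z (i.+1%:Z - b%:Z))
    - binz (2 * a + q)%:Z (i.+1%:Z + b%:Z) * binz q.+2%:Z (i.+1%:Z - b%:Z)
    - binz (2 * a + q).+2%:Z (i.+1%:Z + b%:Z) * binz q%:Z (i.+1%:Z - b%:Z).
Proof.
rewrite /cyl_det /cyl !binz_pascal.
have -> : (a + q.+1)%N%:Z - a%:Z - 1 = q%:Z by lia.
have -> : (a + q.+1)%N%:Z + a%:Z - 1 = (2 * a + q)%N%:Z by lia.
have -> : i%:Z - b%:Z - 0 = i.+1%:Z - b%:Z - 1 by lia.
have -> : i%:Z - b%:Z - 1 = i.+1%:Z - b%:Z - 1 - 1 by lia.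
have -> : i%:Z - b%:Z - -1 = i.+1%:Z - b%:Z by lia.
have -> : i%:Z + b%:Z + 0 = i.+1%:Z + b%:Z - 1 by lia.
have -> : i%:Z + b%:Z + 1 = i.+1%:Z + b%:Z by lia.
have -> : i%:Z + b%:Z + -1 = i.+1%:Z + b%:Z - 1 - 1 by lia.
ring.
Qed.

(* The hypotheses a < b or b = 0 cover s > 0 and s = 0. When j <= a or n <= b,
   where Nanjundiah's identity does not apply, both sides vanish. *)
Lemma cyl_det_step (a b n j : nat) :
    (a <= b)%N -> (a < b)%N || (b == 0)%N -> (0 < n)%N -> (0 < j)%N ->
  \sum_(i < j.+1) 'C(n + i, 2 * j)%:R * cyl_det a%:Z b%:Z j i =
  cyl_det b%:Z (2 * b%:Z - a%:Z) n j.
Proof.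
move=> ab ab' n0 j0; have [ja|aj] := leqP j a.
  rewrite [RHS]cyl_det_eq0; last first.
    by move=> c hc; rewrite /cyl binz_lt0 ?mul0r //; lia.
  apply: big1 => i _; rewrite cyl_det_eq0 ?mulr0 // => c hc; rewrite /cyl.
  have ij := ltn_ord i.
  have [h|h] := boolP (i%:Z - b%:Z - c < 0); first by rewrite binz_lt0 ?mul0r.
  by rewrite [X in _ * X]binz_small ?mulr0 //; lia.
have [nb|bn] := leqP n b.
  rewrite [RHS]cyl_det_eq0; last first.
    move=> c hc; rewrite /cyl.
    have [h|h] := boolP (j%:Z - (2 * b%:Z - a%:Z) - c < 0).
      by rewrite binz_lt0 ?mul0r.
    by rewrite [X in _ * X]binz_small ?mulr0 //; lia.
  apply: big1 => i _; have [h|h] := ltnP (n + i) (2 * j).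
    by rewrite bin_small // mul0r.
  rewrite cyl_det_eq0 ?mulr0 // => c hc; rewrite /cyl.
  by rewrite [X in _ * X]binz_small ?mulr0 //; lia.
have [q jE] : exists q, j = (a + q.+1)%N by exists (j - a.+1)%N; lia.
(* The range goes up to [i = j + 1] because [p1] is [j + a + 1] at [c = -1]. *)
have cylE c p1 q1 : p1%:Z = j%:Z + a%:Z - c -> q1%:Z = j%:Z - a%:Z + c ->
    (-1 <= c) ->
    cyl b%:Z (2 * b%:Z - a%:Z) c n j =
    \sum_(i < j.+2) 'C(n + i - 1, 2 * j)%:R *
      (binz p1%:Z (i%:Z + b%:Z) * binz q1%:Z (i%:Z - b%:Z)).
  move=> hp hq hc; have -> : (2 * j = p1 + q1)%N by lia.
  rewrite sum_binz //; last by lia.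
  by rewrite /cyl; congr (binz _ _ * binz _ _); lia.
rewrite {2}/cyl_det (cylE 0 (2 * a + q).+1 q.+1) ?(cylE 1 (2 * a + q)%N q.+2)
  ?(cylE (-1) (2 * a + q).+2 q) //; try lia.
rewrite mulr_sumr -!sumrB [RHS]big_ord_recl /=.
(* The term [i = 0] has a negative lower index if [b > 0]; if [b = 0] its three parts cancel as 2 -
   1 - 1. *)
rewrite [X in _ = X + _](_ : _ = 0) ?add0r; last first.
  have [b0|b0] := posnP b; last first.
    by rewrite ![binz _ (- _)]binz_lt0 ?mulr0 ?subr0 //; lia.
  by rewrite b0 oppr0 !binz_nat !bin0; ring.
apply: eq_bigr => i _; have := cyl_det_shift a q b i; rewrite -jE => ->.
rewrite /bump /= add1n addnS subn1 /=; ring.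
Qed.

(** * Summation over [s] *)

Lemma cyl_small (a b c : int) (n j : nat) :
  j%:Z - b < c -> cyl a b c n j = 0.
Proof. by move=> h; rewrite /cyl binz_lt0 ?mul0r //; lia. Qed.

Lemma Qtilde_cyl (a : int) (n j r m : nat) : -1 <= a -> (j.+2 <= m)%N ->
  Qtilde a n j r.+1 =
  \sum_(1 <= s < m) cyl (r * s)%N%:Z (r.+1 * s)%N%:Z a n j.
Proof.
move=> a1 jm; rewrite /Qtilde (@fsbigE _ _ _ _ _ (index_iota 1 m)).
- rewrite big_seq_cond [RHS]big_seq_cond; apply: eq_big => s.
    rewrite mem_index_iota; case: (boolP (1 <= s)%N) => //= s1.
    by rewrite mem_set // andbT.
  by move=> _; rewrite /Qtilde_term /cyl; congr (binz _ _ * binz _ _); lia.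
- exact: iota_uniq.
- by move=> s /=; rewrite mem_index_iota => /andP[].
- move=> s /= s1; rewrite mem_index_iota s1 /= -leqNgt => ms.
  by rewrite /Qtilde_term binz_lt0 ?mul0r //; nia.
Qed.

(* Here [r] is the paper's k + 1, so that a = rs and b = (r+1)s are naturals. *)
Definition cyl_sum (r n j : nat) : rat :=
  cyl_det 0 0 n j / 2 +
  \sum_(1 <= s < j.+2) cyl_det (r * s)%N%:Z (r.+1 * s)%N%:Z n j.

(** A bound common to all [i <= j] is what allows the sums over [i] and [s] to be exchanged. The
    cutoff is [j.+2], not [j.+1], because of the shift [c = -1]. *)
Lemma cyl_sum_widen (r n j m : nat) : (j.+2 <= m)%N ->
  cyl_sum r n j = cyl_det 0 0 n j / 2 +
    \sum_(1 <= s < m) cyl_det (r * s)%N%:Z (r.+1 * s)%N%:Z n j.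
Proof.
move=> jm; rewrite /cyl_sum [in RHS](big_cat_nat (n := j.+2)) //=.
rewrite [X in _ = _ + (_ + X)]big_nat_cond [X in _ = _ + (_ + X)]big1 ?addr0 //.
move=> s /andP[/andP[js _] _]; apply: cyl_det_eq0 => c hc.
by apply: cyl_small; nia.
Qed.

Lemma cyl_sum_Qtilde (r n j : nat) :
  cyl_sum r n j = cyl_det 0 0 n j / 2 -
    (Qtilde 1 n j r.+1 - 2 * Qtilde 0 n j r.+1 + Qtilde (-1) n j r.+1).
Proof.
rewrite /cyl_sum !(@Qtilde_cyl _ _ _ _ j.+2) // mulr_sumr -sumrB -big_split /=.
by rewrite -sumrN; congr (_ + _); apply: eq_bigr => s _; rewrite /cyl_det; ring.
Qed.

Lemma cyl_sum_step (r n j : nat) : (0 < n)%N -> (0 < j)%N ->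
  \sum_(i < j.+1) 'C(n + i, 2 * j)%:R * cyl_sum r j i = cyl_sum r.+1 n j.
Proof.
move=> n0 j0; rewrite /cyl_sum.
transitivity (\sum_(i < j.+1) ('C(n + i, 2 * j)%:R * cyl_det 0 0 j i / 2 +
   \sum_(1 <= s < j.+2)
     'C(n + i, 2 * j)%:R * cyl_det (r * s)%N%:Z (r.+1 * s)%N%:Z j i)).
  apply: eq_bigr => i _; rewrite -/(cyl_sum _ _ _) (@cyl_sum_widen _ _ _ j.+2).
    by rewrite mulrDr mulrA mulr_sumr.
  by rewrite !ltnS -ltnS.
rewrite big_split /= -mulr_suml (cyl_det_step 0 0) //; congr (_ + _).
rewrite exchange_big /= big_nat [RHS]big_nat; apply: eq_bigr => s /andP[s1 _].
rewrite cyl_det_step //; first by congr cyl_det; lia.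
  by rewrite leq_mul2r leqnSn orbT.
by rewrite ltn_mul2r s1 ltnSn.
Qed.

Lemma cyl_sum0 (n j : nat) : (0 < n)%N -> cyl_sum 0 n j = 0.
Proof.
move=> n0; pose u (s : int) := cyl 0 s 0 n j.
have uE (s c : int) : cyl 0 s c n j = u (s + c).
  by rewrite /u /cyl; congr (binz _ _ * binz _ _); lia.
(* At [a = 0], negating [s] swaps the two factors. Hence the halved term is [u 0 - u 1], which is
   [f 1] and cancels the lower end of the telescope. *)
have uN : u (-1) = u 1.
  by rewrite /u /cyl mulrC; congr (binz _ _ * binz _ _); lia.
pose f (s : nat) : rat := u (s%:Z - 1) - u s%:Z.
rewrite /cyl_sum.
rewrite (eq_bigr (fun s => f s.+1 - f s)); last first.
  move=> s _; rewrite /cyl_det mul0n mul1n !uE addr0 /f.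
  have -> : s.+1%:Z - 1 = s%:Z by lia.
  have -> : s.+1%:Z = s%:Z + 1 by lia.
  ring.
rewrite telescope_sumr // /cyl_det !uE !add0r /f uN.
have -> : u (j.+2%:Z - 1) = 0 by rewrite /u cyl_small //; lia.
have -> : u j.+2%:Z = 0 by rewrite /u cyl_small //; lia.
by rewrite subrr; field.
Qed.

(** The term [s = 1] vanishes since [r.+2 > 1]. With [r] in place of [r.+1] this would fail at
    [r = 0], where [cyl_sum0] gives 0. *)
Lemma cyl_sum_j0 (r n : nat) : (0 < n)%N -> cyl_sum r.+1 n 0 = 1.
Proof.
move=> n0; rewrite /cyl_sum big_nat1 [X in _ + X]cyl_det_eq0 => [|c hc].
  have h : n%:Z - 1 = n.-1%:Z by lia.
  rewrite /cyl_det (@cyl_small _ _ 1) // /cyl !subr0 h binz_nat bin0.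
  by rewrite [X in _ - X]mulrC binz_lt0 // mul0r; field.
by apply: cyl_small; lia.
Qed.

Lemma narayana_cyl (n j : nat) : (0 < n)%N ->
  narayana n j.+1 = cyl_det 0 0 n j / 2.
Proof.
case: n => // n _; rewrite /narayana /= /cyl_det /cyl !subr0.
have -> : n.+1%:Z - 1 = n%:Z by lia.
have n1 : n.+1%:R != 0 :> rat by rewrite pnatr_eq0.
have -> : j%:Z - -1 = j%:Z + 1 by lia.
pose x := binz n%:Z (j%:Z - 1).
have h1 : n.+1%:R * 'C(n, j)%:R = j.+1%:R * 'C(n.+1, j.+1)%:R :> rat.
  by rewrite -!natrM mul_bin_diag.
have pascal : 'C(n.+1, j)%:R = 'C(n, j)%:R + x.
  by rewrite -!binz_nat binz_pascal.
have h2 : n.+1%:R * x = j%:R * 'C(n.+1, j)%:R :> rat.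
  rewrite /x; case: (j) => [|i]; first by rewrite binz_lt0 // mulr0 mul0r.
  have -> : i.+1%:Z - 1 = i%:Z by lia.
  by rewrite binz_nat -!natrM mul_bin_diag.
have -> : j%:Z + 1 = j.+1%:Z by lia.
rewrite pascal binS natrD !binz_nat -/x in h1 h2 *.
apply: (mulfI n1); rewrite !mulrA mulfV // mul1r.
set c := 'C(n, j)%:R in h1 h2 *; set e := 'C(n, j.+1)%:R in h1 *.
(* Evaluating [n.+1 * c * x] through [h1] and through [h2] eliminates [n]; the goal is then linear
   in the monomials of this relation. *)
have hx : j.+1%:R * (e + c) * x = j%:R * (c + x) * c :> rat.
  by rewrite -h1 -h2; ring.
transitivity (c * (n.+1%:R * c) - e * (n.+1%:R * x)); last by field.
rewrite h1 h2 -natr1 in hx *.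
lra.
Qed.

(** * Recursion for the sum over chains *)

(* [chain_rec k j n]: sum over all chains ending with i_k = j, i_{k+1} = n. *)
Fixpoint chain_rec (k j n : nat) : nat :=
  if k is k'.+1 then \sum_(i < j.+1) 'C(n + i, 2 * j) * chain_rec k' i j
  else (j == 0).

Lemma chain_rec_j0 (k n : nat) : chain_rec k 0 n = 1%N.
Proof.
by elim: k n => [|k IHk] n //=; rewrite big_ord1 IHk bin0.
Qed.

Lemma chain_rec_cyl_sum (k j n : nat) : (0 < n)%N ->
  (chain_rec k j n)%:R = cyl_sum k.+1 n j.
Proof.
elim: k j n => [|k IHk] [|j] n n0; rewrite ?chain_rec_j0 ?cyl_sum_j0 //.
  (* For [k = 0] and a positive last index, one step further down reaches [cyl_sum 0], which is
     0. *)
  by rewrite -cyl_sum_step // big1 // => i _; rewrite cyl_sum0 ?mulr0.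
rewrite -cyl_sum_step //= natr_sum; apply: eq_bigr => i _.
by rewrite natrM IHk.
Qed.

Lemma big_rcons_tuple (R : Type) (idx : R) (op : Monoid.com_law idx)
    (T : finType) (k : nat) (F : seq T -> R) :
  \big[op/idx]_(t : k.+1.-tuple T) F t =
  \big[op/idx]_(x : T) \big[op/idx]_(t : k.-tuple T) F (rcons t x).
Proof.
rewrite pair_bigA /=.
rewrite (reindex (fun p : T * k.-tuple T => [tuple of rcons p.2 p.1])) //=.
apply/onW_bij/inj_card_bij => [[x s] [y t] /(congr1 val) /= /rcons_inj[st ->]|].
  by rewrite (val_inj st).
by rewrite card_prod !card_tuple expnS.
Qed.

(** Induction on the last entry, which takes over the role of [j]. The type ['I_N] must not vary
    with [j], so the bound by [j] is expressed by sortedness after appending [j]. *)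
Lemma sum_chains_rec (N k j n : nat) : (j < N)%N ->
  (\sum_(t : k.-tuple 'I_N | sorted leq (rcons (map val t) j))
     let I := nth 0 (ext_seq n j (map val t)) in
     \prod_(0 <= m < k.+1) 'C(I (m + 2) + I m, 2 * I (m + 1)))%N =
  chain_rec k.+1 j n.
Proof.
elim: k j n => [|k IHk] j n jN.
  rewrite (big_pred1 [tuple]) => [|t]; last by rewrite tuple0 /= eqxx.
  cbv zeta; rewrite big_nat1 /= big_ord_recl /= muln1 big1 ?addn0 // => i _.
  by rewrite muln0.
rewrite big_mkcond (big_rcons_tuple _ _ _ _ _ (fun t : seq 'I_N =>
  if sorted leq (rcons (map val t) j) then
     let I := nth 0 (ext_seq n j (map val t)) in
     \prod_(0 <= m < k.+2) 'C(I (m + 2) + I m, 2 * I (m + 1)) else 0)%N) /=.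
rewrite (big_ord_widen _ (fun i => 'C(n + i, 2 * j) * chain_rec k.+1 i j)%N jN).
rewrite [RHS]big_mkcond /=; apply: eq_bigr => x _.
rewrite -big_mkcond /= ltnS.
have sortedE (s : seq nat) :
    sorted leq (rcons (rcons s x) j) = sorted leq (rcons s x) && (x <= j)%N.
  by case: s => [|y s] /=; rewrite ?andbT // !rcons_path last_rcons.
under eq_bigl => t do rewrite map_rcons sortedE.
case: leqP => xj; last by apply: big_pred0 => t; rewrite andbF.
under eq_bigl => t do rewrite andbT.
rewrite -[RHS]/('C(n + x, 2 * j) * chain_rec k.+1 x j)%N.
rewrite -(IHk x j (ltn_ord x)) big_distrr /=; apply: eq_bigr => t _.
have sz : size (map val t) = k by rewrite size_map size_tuple.
(* Only the new last entry [n] differs from the shorter chain ending in [x], [j], so all factors but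
   the last agree. *)
have extE : ext_seq n j (rcons (map val t) x) = rcons (ext_seq j x (map val t)) n.
  by rewrite /ext_seq -cats1 -catA /= -cats1 /= -catA.
have szE : size (ext_seq j x (map val t)) = k.+3 by rewrite /= size_cat sz addn2.
have nth_lt m : (m < k.+3)%N ->
    nth 0%N (ext_seq n j (rcons (map val t) x)) m = nth 0%N (ext_seq j x (map val t)) m.
  by move=> mk; rewrite extE nth_rcons szE mk.
have nth_n : nth 0%N (ext_seq n j (rcons (map val t) x)) k.+3 = n.
  by rewrite extE nth_rcons szE ltnn eqxx.
have nth_x : nth 0%N (ext_seq j x (map val t)) k.+1 = x.
  by rewrite /= nth_cat sz ltnn subnn.
have nth_j : nth 0%N (ext_seq j x (map val t)) k.+2 = j.
  by rewrite /= nth_cat sz ltnNge leqnSn subSnn.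
rewrite map_rcons big_nat_recr // addn2 addn1 nth_n !nth_lt //.
rewrite nth_x nth_j [RHS]mulnC; congr (_ * _)%N.
rewrite big_nat [RHS]big_nat; apply: eq_bigr => m /andP[_ mk].
by rewrite !nth_lt //; lia.
Qed.

Lemma chain_sum_rec (n j k : nat) : (0 < k)%N -> chain_sum n j k = chain_rec k j n.
Proof.
case: k => // k _; rewrite -(@sum_chains_rec j.+1) //; apply: eq_bigl => t /=.
(* Appending an upper bound of the entries preserves sortedness. *)
suff: all (fun y => y <= j)%N (map val t).
  case: (map val t) => //= y s; elim: s y => [|z s IHs] y /= /andP[yj].
    by rewrite yj.
  by move=> /IHs ->.
by apply/allP => _ /mapP[i _ ->]; rewrite -ltnS ltn_ord.
Qed.

Theorem theorem23 (n j k : nat) (hn : (1 <= n)%N) (hk : (2 <= k)%N) :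
  (chain_sum n j k)%:R =
  narayana n j.+1 -
    (Qtilde 1 n j (k + 2) - 2 * Qtilde 0 n j (k + 2) + Qtilde (-1) n j (k + 2)).
Proof.
rewrite chain_sum_rec ?(ltnW hk) // chain_rec_cyl_sum // cyl_sum_Qtilde.
by rewrite narayana_cyl // addn2.
Qed.
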